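(* Let $a\in\mathbb{R}\cup\{-\infty\}$, $b\in\mathbb{R}\cup\{+\infty\}$, $a<b$, and let $\gamma:[a,b)\to\mathbb{E}^2$ be a continuous parametric curve in the Euclidean plane (continuity at $a=-\infty$ being understood in the order topology of the extended real line) which is not constant on any neighborhood of the point $a$. For $t\in[a,b)$ let $D(t)$ be the Euclidean distance between $\gamma(a)$ and $\gamma(t)$. For $t\in(a,b)$ let $S(t)$ be the set of all $\tau\in(a,t]$ such that $\gamma(\tau)$ is a support point for the chord $[\gamma(a),\gamma(t)]$, and let $DS(t)=\sup\{D(\tau)\,:\,\tau\in S(t)\}$; when $D(t)=0$ set $DS(t)/D(t)=+\infty$. Then $$\varlimsup_{t\to a}\frac{DS(t)}{D(t)}\ \geq\ \frac{1}{e}.$$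
   Context: Support points: let $\gamma:I\to\mathbb{E}^2$ be a continuous curve on an interval $I$ and $[c,d]\subset I$. If $\gamma(c)\neq\gamma(d)$, a point $\gamma(\tau_0)$ with $\tau_0\in[c,d]$ is called a support point for the chord $[\gamma(c),\gamma(d)]$ if the straight line $l$ through $\gamma(\tau_0)$ parallel to the segment $[\gamma(c),\gamma(d)]$ has the property that for all $\tau\in I$ sufficiently close to $\tau_0$ the points $\gamma(\tau)$ lie in one and the same (closed) half-plane determined by $l$; equivalently, $\tau_0$ is a point of local extremum of $\tau\mapsto\det\bigl(\gamma(d)-\gamma(c),\ \gamma(\tau)\bigr)$ (determinant of the $2\times2$ matrix with these rows, in Cartesian coordinates). If $\gamma(c)=\gamma(d)$, then by convention every point $\gamma(\tau_0)$ with $\tau_0\in[c,d]$ is a support point for the (degenerate) chord $[\gamma(c),\gamma(d)]$. *)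

(* Defs.v *)
(* Parameter line: extended reals \bar R (so that
   a = -oo and continuity at -oo are handled by the order topology of \bar R). *)
From HB Require Import structures.
From mathcomp Require Import all_boot all_order all_algebra.
From mathcomp Require Import all_classical all_reals all_analysis.
Set Implicit Arguments. Unset Strict Implicit. Unset Printing Implicit Defensive.
Import Order.TTheory GRing.Theory Num.Theory.
Import numFieldNormedType.Exports.
Local Open Scope classical_set_scope.
Local Open Scope ring_scope.

Section Defs.
Variable R : realType.

Definition chord_det (p1 p2 w : R * R) : R :=
  (p2.1 - p1.1) * w.2 - (p2.2 - p1.2) * w.1.

Definition edist (p q : R * R) : R :=
  Num.sqrt ((p.1 - q.1) ^+ 2 + (p.2 - q.2) ^+ 2).

Definition local_extremum_in (I : set (\bar R)) (f : \bar R -> R) (x0 : \bar R) :=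
  exists U, nbhs x0 U /\
    ((forall x, U x -> I x -> f x <= f x0) \/
     (forall x, U x -> I x -> f x0 <= f x)).

Definition support_point (I : set (\bar R)) (gamma : \bar R -> R * R)
    (c d tau0 : \bar R) : Prop :=
  (c <= tau0 <= d)%O /\
  (gamma c <> gamma d ->
     local_extremum_in I (fun tau => chord_det (gamma c) (gamma d) (gamma tau)) tau0).

Definition Dfun (gamma : \bar R -> R * R) (a t : \bar R) : R :=
  edist (gamma a) (gamma t).

Definition Sset (a b : \bar R) (gamma : \bar R -> R * R) (t : \bar R) : set (\bar R) :=
  [set tau | (a < tau <= t)%O /\
             support_point [set x | (a <= x < b)%O] gamma a t tau].

Definition DSfun (a b : \bar R) (gamma : \bar R -> R * R) (t : \bar R) : \bar R :=
  ereal_sup [set (Dfun gamma a tau)%:E | tau in Sset a b gamma t].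

Definition ratioDS (a b : \bar R) (gamma : \bar R -> R * R) (t : \bar R) : \bar R :=
  if Dfun gamma a t == 0 then +oo%E
  else (DSfun a b gamma t * ((Dfun gamma a t)^-1)%:E)%E.

End Defs.

(* Main.v *)
(* Suppose that near [a] every support point [tau] of the chord from [gamma a] to
   [gamma t] satisfies [D tau <= q * D t] with [q = exp (- c)] and [c > 1]. With
   the origin at [gamma a], the determinant [f t tau] of the vectors [gamma t] and
   [gamma tau] then has no local extremum in [tau] while [D tau > q * D t], so on
   such an arc ending at [t] it is strictly monotone and of constant sign; in
   particular the curve turns about the origin in one fixed sense.

   Let [x_k] be the last parameter before [x_0] where [D] equals
   [lambda ^ k * D x_0], with [lambda = exp (- c / (n + 1))], and let [beta_k] be
   the angle between [gamma (x_k)] and [gamma (x_(k+1))]. Monotonicity of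
   [f (x_j)] between [x_(j+n+1)] and [x_(j+n)] yields
     sin beta_(j+n) > (1 / lambda - 1) * tan (beta_j + ... + beta_(j+n-1))
                    >= (1 / lambda - 1) * (sin beta_j + ... + sin beta_(j+n-1)).
   Since [(1 / lambda - 1) * n >= c * n / (n + 1) > 1] for large [n], the sines
   [sin beta_k] are unbounded, which is absurd. *)
Require Import Defs.
From HB Require Import structures.
From mathcomp Require Import all_boot all_order all_algebra.
From mathcomp Require Import all_classical all_reals all_analysis.
From mathcomp Require Import zify ring lra.
Import Order.TTheory GRing.Theory Num.Theory.
Import numFieldNormedType.Exports.
Local Open Scope classical_set_scope.
Local Open Scope ring_scope.
Set Implicit Arguments.
Unset Strict Implicit.
Unset Printing Implicit Defensive.

(** * Growing sequences and rotations of unit vectors *)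

(** A lower bound [v] on [n] consecutive terms persists for all later ones, as [eps * n > 1], and
    improves to [eps * n * v] beyond that window. Window by window the bounds grow geometrically. *)
Lemma unbounded_of_window_growth (R : archiRealFieldType) (b : nat -> R) (eps : R)
    (n : nat) :
  (forall i, 0 < b i) -> 0 < eps -> 1 < eps * n%:R ->
  (forall j, eps * (\sum_(i < n) b (j + i)%N) < b (j + n)%N) ->
  forall M : R, exists i, M < b i.
Proof.
move=> b_gt0 eps_gt0 epsn_gt1 growth M.
have [m m_gt0 m_le] : exists2 m, 0 < m & forall i, (i < n)%N -> m <= b i.
  elim: (n) => [|k [m m_gt0 m_le]]; first by exists 1.
  exists (Num.min m (b k)) => [|i]; first by rewrite lt_min m_gt0 b_gt0.
  rewrite ltnS leq_eqVlt => /predU1P[->|/m_le]; first by rewrite ge_min lexx orbT.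
  by rewrite ge_min => ->.
have step v p : (forall i, (p <= i < p + n)%N -> v <= b i) -> 0 < v ->
    forall i, (p + n <= i)%N -> eps * n%:R * v <= b i.
  move=> base v_gt0.
  have window j : (forall i, (j <= i < j + n)%N -> v <= b i) ->
      eps * n%:R * v <= b (j + n)%N.
    move=> vb; apply: le_trans (ltW (growth j)).
    rewrite -mulrA ler_pM2l // -[n in n%:R]card_ord mulr_natl -sumr_const.
    by apply: ler_sum => i _; apply: vb; rewrite leq_addr ltn_add2l ltn_ord.
  have all_v i : (p <= i)%N -> v <= b i.
    elim/ltn_ind: i => i IH pi.
    have [ipn|pni] := ltnP i (p + n); first by rewrite base // pi.
    have ni : (n <= i)%N by apply: leq_trans pni; rewrite leq_addl.
    rewrite -(subnK ni); apply: le_trans (window _ _).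
      by rewrite ler_peMl // ltW.
    move=> k /andP[ik]; rewrite subnK // => ki; apply: IH => //.
    by apply: leq_trans ik; rewrite leq_subRL // addnC.
  move=> i pni; have ni : (n <= i)%N by apply: leq_trans pni; rewrite leq_addl.
  rewrite -(subnK ni); apply: window => k /andP[ik _]; apply: all_v.
  by apply: leq_trans ik; rewrite leq_subRL // addnC.
have pow p : forall i, (p * n <= i < p * n + n)%N -> (eps * n%:R) ^+ p * m <= b i.
  elim: p => [|p IH] i; first by rewrite mul0n add0n expr0 mul1r; apply: m_le.
  rewrite exprS -mulrA mulSn addnC => /andP[pi _].
  apply: (step _ (p * n)%N) => //; first by rewrite mulr_gt0 // exprn_gt0 // (lt_trans ltr01).
have bern p : 1 + (eps * n%:R - 1) *+ p <= (eps * n%:R) ^+ p.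
  elim: p => [|p IH]; first by rewrite mulr0n addr0.
  have d_gt0 : 0 < eps * n%:R - 1 by rewrite subr_gt0.
  have : 0 <= (eps * n%:R - 1) *+ p by rewrite mulrn_wge0 // ltW.
  by rewrite exprS mulrSr; nra.
have d_gt0 : 0 < (eps * n%:R - 1) * m by rewrite mulr_gt0 // subr_gt0.
set p := Num.bound (`|M| / ((eps * n%:R - 1) * m)).
have Mp : M < (eps * n%:R - 1) * m *+ p.
  apply: le_lt_trans (ler_norm M) _.
  by rewrite -mulr_natr mulrC -ltr_pdivrMr // archi_boundP // divr_ge0 // ltW.
exists (p * n)%N; apply: lt_le_trans Mp (le_trans _ (pow p _ _)).
- rewrite -mulrnAl; apply: ler_wpM2r; first exact: ltW.
  by apply: le_trans (bern p); rewrite lerDr.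
- rewrite leqnn -addn1 leq_add2l lt0n; apply/eqP => n0.
  by move: epsn_gt1; rewrite n0 mulr0 ltNge ler01.
Qed.

Section UnitVectors.
Variables (R : archiRealFieldType) (u v : nat -> R).
Let D j k := u j * v k - v j * u k.
Let B j k := u j * u k + v j * v k.
Hypothesis unit_uv : forall k, u k ^+ 2 + v k ^+ 2 = 1.

(* [D j k] and [B j k] are the sine and cosine of the angle from vector [j] to
   vector [k]; the growth condition makes each elementary sine exceed [eps] times
   the sum of the [n] preceding ones. *)
Lemma no_accelerating_rotation (eps : R) (n : nat) :
  0 < eps -> 1 < eps * n%:R ->
  (forall j k, (j < k <= j + n.+1)%N -> 0 < D j k) ->
  (forall j k, (j < k <= j + n)%N -> (1 + eps) * D j k < D j k.+1) ->
  False.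
Proof.
move=> eps_gt0 epsn_gt1 D_gt0 D_grow.
have n_gt0 : (0 < n)%N.
  by rewrite lt0n; apply/eqP => n0; move: epsn_gt1; rewrite n0 mulr0 ltNge ler01.
have pyth j k : B j k ^+ 2 + D j k ^+ 2 = 1.
  transitivity ((u j ^+ 2 + v j ^+ 2) * (u k ^+ 2 + v k ^+ 2)).
    by rewrite /B /D; ring.
  by rewrite !unit_uv mulr1.
have addS j k : D j k.+1 = D j k * B k k.+1 + B j k * D k k.+1.
  transitivity ((u k ^+ 2 + v k ^+ 2) * D j k.+1); last by rewrite /B /D; ring.
  by rewrite unit_uv mul1r.
have addC j k : B j k.+1 = B j k * B k k.+1 - D j k * D k k.+1.
  transitivity ((u k ^+ 2 + v k ^+ 2) * B j k.+1); last by rewrite /B /D; ring.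
  by rewrite unit_uv mul1r.
have crossE j k : B j k * D j k.+1 - D j k * B j k.+1 = D k k.+1.
  by rewrite (addS j k) (addC j k) -[RHS]mul1r -(pyth j k); ring.
have B_le1 j k : B j k <= 1.
  by have := pyth j k; have := sqr_ge0 (D j k); nra.
have D1_gt0 k : 0 < D k k.+1 by apply: D_gt0; rewrite ltnSn -addn1 leq_add2l.
(* If this cosine were nonpositive, the next sine would be larger and the next cosine smaller still,
   so that their squares would add up to more than 1. *)
have B_gt0 j k : (j < k <= j + n)%N -> 0 < B j k.
  move=> jkn; have jk0 : (j < k <= j + n.+1)%N by lia.
  rewrite ltNge; apply/negP => B_le0.
  have S0 := D_gt0 _ _ jk0; have S1 := D_grow _ _ jkn.
  have cr := crossE j k; have b0 := D1_gt0 k.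
  have := pyth j k; have := pyth j k.+1.
  move: (B j k) (B j k.+1) (D j k) (D j k.+1) (D k k.+1) B_le0 S0 S1 cr b0.
  move=> C C' S S' b C_le0 S_gt0 S'_gt cr b_gt0 p' p.
  have SS' : S < S' by nra.
  have C'C : C' < C.
    have : S * C' < S * C by nra.
    by rewrite ltr_pM2l.
  nra.
(* With [D = sin] and [B = cos] of the angle between vectors [j] and [k], this is
   superadditivity of [tan] on acute angles, together with [sin <= tan]. *)
have tan_ge j k : (j < k <= j + n)%N ->
    \sum_(i < k - j) D (j + i)%N (j + i)%N.+1 <= D j k / B j k.
  elim: k => [//|k IH] /andP[jk kn]; move: jk; rewrite ltnS leq_eqVlt.
  case/predU1P => [->|jk].
    rewrite subSnn big_ord1 /= addn0 ler_pdivlMr ?B_gt0 ?ltnSn //=.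
      by rewrite -[leRHS]mulr1 ler_wpM2l // ltW.
    by rewrite -addn1 leq_add2l.
  have {}IH := IH; rewrite jk (ltnW kn) /= in IH; have {}IH := IH isT.
  rewrite subSn 1?ltnW // big_ord_recr /= subnKC 1?ltnW //.
  apply: le_trans (lerD IH (lexx _)) _.
  have C0 : 0 < B j k by rewrite B_gt0 // jk ltnW.
  have C1 : 0 < B j k.+1 by rewrite B_gt0 // kn andbT ltnW.
  rewrite -lerBrDl.
  have -> : D j k.+1 / B j k.+1 - D j k / B j k = D k k.+1 / (B j k * B j k.+1).
    by rewrite -(crossE j k); field; rewrite !gt_eqF.
  rewrite ler_pdivlMr ?mulr_gt0 // -[leRHS]mulr1 ler_wpM2l ?(ltW (D1_gt0 k)) //.
  by rewrite mulr_ile1 ?(ltW C0) ?(ltW C1) ?B_le1.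
have [|//|//|k|i] := @unbounded_of_window_growth R (fun k => D k k.+1) eps n _ _ _ _ 1.
- exact: D1_gt0.
- have kk : (k < k + n <= k + n)%N by rewrite leqnn andbT -addn1 leq_add2l.
  have := tan_ge _ _ kk; rewrite addKn => sumle.
  have C0 := B_gt0 _ _ kk.
  apply: le_lt_trans (_ : eps * (D k (k + n)%N / B k (k + n)%N) < _).
    by rewrite ler_pM2l.
  (* Bounding the cosine of the next elementary angle by 1 in the addition formula leaves [eps]
     times the tangent below the next sine. *)
  have := D_grow _ _ kk; rewrite (addS k (k + n)%N) mulrA ltr_pdivrMr //.
  have S0 : 0 < D k (k + n)%N.
    by apply: D_gt0; case/andP: kk => -> _; rewrite leq_add2l leqnSn.
  by have := B_le1 (k + n)%N (k + n)%N.+1; nra.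
- by apply/negP; rewrite -leNgt; have := pyth i i.+1; have := sqr_ge0 (B i i.+1); nra.
Qed.
End UnitVectors.

(** * Functions of one real variable *)

Lemma near_itv_radius (R : realFieldType) (x : R) (P : set R) :
  (\forall y \near x, P y) ->
  exists2 e, 0 < e & forall y, x - e < y < x + e -> P y.
Proof.
move=> /nbhs_ballP[e e_gt0]; rewrite ball_itv => xP.
by exists e => // y xy; apply: xP; rewrite /= in_itv.
Qed.

Definition local_extremum (R : realType) (f : R -> R) (x : R) :=
  (\forall y \near x, f y <= f x) \/ (\forall y \near x, f x <= f y).

(** The maximum and the minimum over [[x, z]] can only be attained at endpoints, hence at opposite
    ones, with [f y] strictly between. The product form leaves the direction of monotonicity
    open. *)
Lemma no_extremum_strict_between (R : realType) (f : R -> R) (x y z : R) :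
  x < y < z -> {within `[x, z], continuous f} ->
  (forall c, x < c < z -> ~ local_extremum f c) ->
  0 < (f y - f x) * (f z - f y).
Proof.
move=> /andP[xy yz] fC noext; have xz := ltW (lt_trans xy yz).
have endpoint c : x <= c <= z ->
    (forall t, x <= t <= z -> f t <= f c) \/ (forall t, x <= t <= z -> f c <= f t) ->
    c = x \/ c = z.
  move=> /andP[]; rewrite le_eqVlt => /predU1P[<-|xc]; first by left.
  rewrite le_eqVlt => /predU1P[->|cz fc]; first by right.
  have near_c : \forall t \near c, x <= t <= z.
    have := @near_in_itvoo _ x z c; rewrite in_itv /= xc cz => /(_ isT).
    by apply: filterS => t; rewrite in_itv /= => /andP[xt tz]; rewrite !ltW.
  case: (noext c); rewrite ?xc //.
  by case: fc => fc; [left|right]; apply: filterS near_c => t /fc.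
have [c + fc] := EVT_max xz fC; have [d + fd] := EVT_min xz fC.
rewrite !in_itv /= => dI cI.
have {}fc t : x <= t <= z -> f t <= f c by move=> ?; apply: fc; rewrite in_itv.
have {}fd t : x <= t <= z -> f d <= f t by move=> ?; apply: fd; rewrite in_itv.
have yI : x <= y <= z by rewrite !ltW.
have not_end : ~ (y = x \/ y = z).
  by move=> [yx|yz']; [move: xy; rewrite yx ltxx|move: yz; rewrite yz' ltxx].
have y_lt : f y < f c.
  rewrite lt_neqAle fc // andbT; apply/eqP => yc; apply: not_end.
  by apply: endpoint => //; left=> t; rewrite yc; apply: fc.
have lt_y : f d < f y.
  rewrite lt_neqAle fd // andbT; apply/eqP => yd; apply: not_end.
  by apply: endpoint => //; right=> t; rewrite -yd; apply: fd.
have [cx|cz] := endpoint _ cI (or_introl fc);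
  have [dx|dz] := endpoint _ dI (or_intror fd); subst.
- by have := lt_trans lt_y y_lt; rewrite ltxx.
- by rewrite nmulr_rgt0 ?subr_lt0.
- by rewrite mulr_gt0 ?subr_gt0.
- by have := lt_trans lt_y y_lt; rewrite ltxx.
Qed.

(** The indicator of [P] is continuous and never equals 1/2, so the intermediate value theorem
    forbids a jump. *)
Lemma locally_constant_const (R : realType) (P : R -> Prop) (x y : R) :
  x <= y -> (forall t, x <= t <= y -> \forall s \near t, P s <-> P t) ->
  P x <-> P y.
Proof.
move=> xy Ploc; pose g t : R := if `[< P t >] then 1 else 0.
have gC : {within `[x, y], continuous g}.
  apply: continuous_in_subspaceT => t; rewrite inE /= in_itv /= => /Ploc Pt.
  apply: (@near_cst_continuous _ _ (g t)).
  by apply: filterS Pt => s st; rewrite /g (asbool_equiv_eq st).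
have nohalf c : g c <> 2^-1 by rewrite /g; case: ifP => _; lra.
have [Px|nPx] := pselect (P x); have [Py|nPy] := pselect (P y) => //.
- have [|c _] := @IVT R g x y 2^-1 xy gC; last by move/nohalf.
  rewrite /g (asboolT Px) (asboolF nPy) ge_min le_max; lra.
- have [|c _] := @IVT R g x y 2^-1 xy gC; last by move/nohalf.
  rewrite /g (asboolF nPx) (asboolT Py) ge_min le_max; lra.
Qed.

(** * Plane curves that avoid the origin and come arbitrarily close to it on the left *)

Section PlaneCurve.
Variables (R : realType) (J : set R) (X Y : R -> R).
Let r x := Num.sqrt (X x ^+ 2 + Y x ^+ 2).
(* Up to a constant, the determinant of the context for the chord from the origin
   to the point of parameter [t]. *)
Let f t x := X t * Y x - Y t * X x.
Hypothesis openJ : open J.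
Hypothesis convJ : forall x y z, J x -> J y -> x <= z <= y -> J z.
Hypothesis contX : forall x, J x -> {for x, continuous X}.
Hypothesis contY : forall x, J x -> {for x, continuous Y}.
Hypothesis r_gt0 : forall x, J x -> 0 < r x.
(** Stands in for continuity at the initial parameter, which lies outside [J] in the application and
    may be [-oo]. *)
Hypothesis r_small : forall z e, J z -> 0 < e -> exists x, [/\ J x, x < z & r x < e].

Lemma continuous_radius x : J x -> {for x, continuous r}.
Proof.
move=> Jx.
apply: (@continuous_comp _ _ _ (fun x => X x ^+ 2 + Y x ^+ 2) Num.sqrt); last exact: sqrt_continuous.
apply: (@continuousD _ _ _ (fun x => X x ^+ 2) (fun x => Y x ^+ 2)).
- apply: (@continuous_comp _ _ _ X (fun x => x ^+ 2)); [exact: contX|exact: exprn_continuous].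
- apply: (@continuous_comp _ _ _ Y (fun x => x ^+ 2)); [exact: contY|exact: exprn_continuous].
Qed.

Lemma continuous_det t x : J x -> {for x, continuous (f t)}.
Proof.
move=> Jx; apply: (@continuousB _ _ _ (fun x => X t * Y x) (fun x => Y t * X x)).
- by apply: continuousM; [exact: cst_continuous|exact: contY].
- by apply: continuousM; [exact: cst_continuous|exact: contX].
Qed.

Lemma within_continuous g x y : J x -> J y ->
  (forall t, J t -> {for t, continuous g}) -> {within `[x, y], continuous (g : R -> R)}.
Proof.
move=> Jx Jy gC; apply: continuous_in_subspaceT => t; rewrite inE /= in_itv /= => xty.
by apply: gC; apply: convJ xty.
Qed.

(** The parameter is the supremum [s] of those in [[y, z]] with [r <= v]. Continuity gives
    [r s <= v]; the value [v] is taken on [[s, z]], but not after [s]. *)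
Lemma last_hitting z v : J z -> 0 < v < r z ->
  exists x, [/\ J x, x < z, r x = v & forall t, x < t <= z -> v < r t].
Proof.
move=> Jz /andP[v_gt0 vrz]; have [y [Jy yz ryv]] := r_small Jz v_gt0.
pose A := [set x | y <= x <= z /\ r x <= v].
have Ay : A y by split; [rewrite lexx ltW|exact: ltW].
have ubA : ubound A z by move=> x [/andP[]].
have hsA : has_sup A by split; [exists y|exists z].
set s := sup A.
have ys : y <= s by apply: sup_upper_bound.
have sz : s <= z by apply: ge_sup => //; exists y.
have Js : J s by apply: (convJ Jy Jz); rewrite ys.
have after t : s < t <= z -> v < r t.
  move=> /andP[st tz]; rewrite ltNge; apply/negP => rtv.
  have : t <= s by apply: sup_upper_bound => //; split => //; rewrite tz (le_trans ys) // ltW.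
  by rewrite leNgt st.
have rsv : r s <= v.
  rewrite leNgt; apply/negP => vrs.
  have : \forall t \near s, v < r t by exact: cvgr_gt (continuous_radius Js) _ vrs.
  move=> /near_itv_radius[e e_gt0 se].
  have [x Ax sx] := sup_adherent e_gt0 hsA.
  have : x <= s by apply: sup_upper_bound.
  move=> xs; have := se x; rewrite sx (le_lt_trans xs) ?ltrDl // => /(_ isT).
  by case: Ax => _; rewrite leNgt => /negP.
have [c] : exists2 c, c \in `[s, z] & r c = v.
  apply: IVT => //; first by apply: within_continuous => // t; apply: continuous_radius.
  by rewrite ge_min rsv le_max (ltW vrz) orbT.
rewrite in_itv /= => /andP[]; rewrite le_eqVlt => /predU1P[<- _ rsE|sc cz rcv].
  exists s; split => //; rewrite lt_neqAle sz andbT; apply/eqP => sz'.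
  by move: vrz; rewrite -sz' rsE ltxx.
by have := after c; rewrite sc cz rcv ltxx => /(_ isT).
Qed.

Section NoSupport.
Variable q : R.
Hypothesis q_lt1 : q < 1.
Hypothesis noext : forall t x, J t -> J x -> x < t -> q * r t < r x ->
  ~ local_extremum (f t) x.

(* On such an arc [f t] has no interior local extremum, hence is strictly monotone. *)
Definition outlying x t :=
  [/\ J x, J t, x < t & forall s, x < s < t -> q * r t < r s].

Lemma det_diag t : f t t = 0. Proof. by rewrite /f mulrC subrr. Qed.

(** Along the arc [f t] runs strictly monotonically to its value [0] at [t], so it keeps its sign
    while its absolute value decreases. *)
Lemma outlying_between x s t : outlying x t -> x < s < t ->
  0 < (f t x - f t s) * f t s.
Proof.
move=> [Jx Jt xt far] xst.
have := @no_extremum_strict_between _ (f t) x s t xst.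
rewrite det_diag sub0r => H.
suff : 0 < (f t s - f t x) * - f t s by rewrite mulrN -mulNr opprB.
apply: H; first by apply: within_continuous => // c; apply: continuous_det.
move=> c xct; apply: noext => //; last 2 first.
- by case/andP: xct.
- exact: far.
by apply: (convJ Jx Jt); case/andP: xct => *; rewrite !ltW.
Qed.

Lemma outlying_det_neq0 x t : outlying x t -> f t x != 0.
Proof.
move=> xt; have [_ _ lt_xt _] := xt; have [lx xl] := midf_lt lt_xt.
have := outlying_between (s := (x + t) / 2) xt; rewrite lx xl => /(_ isT) H.
by apply/eqP => f0; move: H; rewrite f0 sub0r; set y := f t _; nra.
Qed.

Lemma outlying_same_sign x y t : outlying x t -> outlying y t -> 0 < f t x -> 0 < f t y.
Proof.
wlog xy : x y / x < y.
  move=> W; have [|yx|->//] := ltgtP x y; first exact: W.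
  move=> cx cy fx; have := outlying_between (s := x) cy.
  case: (cx) => _ _ xt _; rewrite yx xt => /(_ isT); nra.
move=> cx cy fx; have := outlying_between (s := y) cx.
by case: (cy) => _ _ yt _; rewrite xy yt => /(_ isT); nra.
Qed.

(* [f t] has a constant sign on every outlying arc ending at [t]; that sign is the
   sense of rotation of the curve about the origin, without a lift of the angle. *)
Definition clockwise t := exists2 x, outlying x t & 0 < f t x.

(** A level [w] strictly between [q * r t] and [r t] separates [q * r s] from [r c] for all [s] and
    [c] near [t]; hence one starting point serves all nearby end points. *)
Lemma outlying_near t : J t ->
  exists2 x, outlying x t & \forall s \near t, outlying x s.
Proof.
move=> Jt; have rt := r_gt0 Jt; have qr : q * r t < r t by rewrite gtr_pMl.
have [qw wr] := midf_lt qr; set w := (_ / 2) in qw wr.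
have : \forall s \near t, [/\ J s, w < r s & q * r s < w].
  near=> s; split; near: s; first exact: open_nbhs_nbhs.
  - exact: cvgr_gt (continuous_radius Jt) _ wr.
  - apply: (cvgr_lt (q * r t)) qw.
    by apply: cvgM; [exact: cvg_cst|exact: continuous_radius].
move=> /near_itv_radius[e e_gt0 te].
have clr s : t - e / 2 < s < t + e -> outlying (t - e / 2) s.
  move=> /andP[xs se]; have [|Js _ qs] := te s; first lra.
  have [|Jx _ _] := te (t - e / 2); first lra.
  split => // c /andP[xc cs]; have [|_ wc _] := te c; first lra.
  exact: lt_trans wc.
exists (t - e / 2); first by apply: clr; lra.
have := @near_in_itvoo _ (t - e / 2) (t + e) t; rewrite in_itv /=.
have -> : t - e / 2 < t < t + e by lra.
by move=> /(_ isT); apply: filterS => s; rewrite in_itv /=; apply: clr.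
Unshelve. all: by end_near. Qed.

Lemma det_sym s t : f s t = - f t s.
Proof. by rewrite /f; ring. Qed.

(** With a common starting point [x] for all [s] near [t], the sense of rotation is the sign of
    [f s x], which is continuous in [s] and nonzero at [t]. *)
Lemma clockwise_locally_constant t : J t ->
  \forall s \near t, clockwise s <-> clockwise t.
Proof.
move=> Jt; have [x cx near_cx] := outlying_near Jt.
have cwE s : outlying x s -> clockwise s <-> 0 < f s x.
  move=> cs; split=> [[y cy fy]|fx]; last by exists x.
  exact: outlying_same_sign fy.
have contf : f s x @[s --> t] --> f t x.
  rewrite det_sym; under eq_fun do rewrite det_sym.
  by apply: cvgN; apply: continuous_det.
have : \forall s \near t, 0 < f s x <-> 0 < f t x.
  have := outlying_det_neq0 cx; rewrite neq_lt => /orP[fx|fx].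
  - apply: filterS (cvgr_lt _ contf _ fx) => s fs.
    by split => ?; exfalso; lra.
  - by apply: filterS (cvgr_gt _ contf _ fx) => s fs.
apply: filterS2 near_cx => s cs sgn.
by rewrite !cwE.
Qed.

Lemma clockwise_const s t : J s -> J t -> clockwise s <-> clockwise t.
Proof.
wlog st : s t / s <= t.
  move=> W Js Jt; have [|/ltW] := leP s t; first by move=> /W; apply.
  by move=> /W /(_ Jt Js) H; rewrite H.
move=> Js Jt; apply: locally_constant_const => // c stc.
by apply: clockwise_locally_constant; apply: convJ stc.
Qed.

Lemma last_hitting_sequence lam z : J z -> 0 < lam < 1 ->
  exists x : nat -> R, [/\ forall k, J (x k), forall k, x k.+1 < x k,
    forall k, r (x k.+1) = lam * r (x k) &
    forall k t, x k.+1 < t <= x k -> r (x k.+1) < r t].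
Proof.
move=> Jz /andP[lam_gt0 lam_lt1].
(* Membership in [J] is packed into the subtype so that the chosen map can be iterated. *)
have step (y : {y | J y}) : exists y' : {y | J y}, [/\ sval y' < sval y,
    r (sval y') = lam * r (sval y) &
    forall t, sval y' < t <= sval y -> r (sval y') < r t].
  case: y => y Jy /=; have ry := r_gt0 Jy.
  have [|x [Jx xy rx far]] := @last_hitting y (lam * r y) Jy.
    by rewrite mulr_gt0 // gtr_pMl.
  by exists (exist _ x Jx) => /=; split => // t /far; rewrite rx.
have [h hP] := choice step.
exists (fun k => sval (iter k h (exist _ z Jz))); split => k /=.
- exact: svalP.
- by have [] := hP (iter k h (exist _ z Jz)).
- by have [] := hP (iter k h (exist _ z Jz)).
- by have [] := hP (iter k h (exist _ z Jz)).
Qed.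

Lemma no_support_contradiction lam n z : J z -> 0 < lam < 1 ->
  q <= lam ^+ n.+1 -> 1 < (lam^-1 - 1) * n%:R -> False.
Proof.
move=> Jz lam01 q_le large.
have [lam_gt0 lam_lt1] := andP lam01.
have [x [Jx x_dec rx far]] := last_hitting_sequence Jz lam01.
have x_lt j d : x (j + d.+1)%N < x j.
  elim: d => [|d IH]; first by rewrite addn1.
  by rewrite addnS; apply: lt_trans IH.
have r_pow j d : r (x (j + d)%N) = lam ^+ d * r (x j).
  elim: d => [|d IH]; first by rewrite addn0 expr0 mul1r.
  by rewrite addnS rx IH exprS mulrA.
have far_all j d t : x (j + d.+1)%N < t <= x j -> r (x (j + d.+1)%N) < r t.
  elim: d => [|d IH]; first by rewrite addn1; apply: far.
  rewrite addnS => /andP[xt tx]; have [|xdt] := leP t (x (j + d.+1)%N).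
    by move=> txd; apply: far; rewrite xt.
  apply: lt_trans (IH _); last by rewrite xdt.
  by rewrite rx gtr_pMl // r_gt0.
(* Up to [n + 1] steps multiply the radius by at least [lam ^+ n.+1 >= q], so the arc stays outside
   the radius [q * r (x j)]. *)
have outlying_x j k : (j < k <= j + n.+1)%N -> outlying (x k) (x j).
  move=> jk; have kE : k = (j + (k - j).-1.+1)%N by lia.
  split; rewrite ?Jx //; first by rewrite kE.
  move=> s /andP[xs sx]; apply: le_lt_trans (_ : r (x k) < _); last first.
    by rewrite kE far_all // -kE xs ltW.
  rewrite kE r_pow ler_wpM2r //; first exact: ltW (r_gt0 _).
  apply: le_trans q_le _; apply: ler_wiXn2l; [exact: ltW|exact: ltW|lia].
(* The sign [s] reflects the plane, if necessary, so that the curve turns in the positive sense. *)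
have [s [s2 sF]] : exists s : R, s ^+ 2 = 1 /\
    forall j k, (j < k <= j + n.+1)%N -> 0 < s * f (x j) (x k).
  have [cw|ncw] := pselect (clockwise z).
    exists 1; split => [|j k jk]; first by rewrite expr1n.
    have [y cy fy] : clockwise (x j) by apply/(clockwise_const Jz (Jx j)).
    by rewrite mul1r; apply: outlying_same_sign (outlying_x _ _ jk) fy.
  exists (-1); split => [|j k jk]; first by rewrite sqrrN expr1n.
  have ck := outlying_x _ _ jk; rewrite mulN1r oppr_gt0 lt_neqAle outlying_det_neq0 //=.
  rewrite leNgt; apply/negP => fk; apply: ncw.
  by apply/(clockwise_const Jz (Jx j)); exists (x k).
have rx_gt0 k : 0 < r (x k) by exact: r_gt0.
have rsq k : r (x k) ^+ 2 = X (x k) ^+ 2 + Y (x k) ^+ 2.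
  by rewrite sqr_sqrtr // addr_ge0 ?sqr_ge0.
have detE j k : X (x j) / r (x j) * (s * Y (x k) / r (x k)) -
    s * Y (x j) / r (x j) * (X (x k) / r (x k)) =
    s * f (x j) (x k) / (r (x j) * r (x k)).
  by rewrite /f; field; rewrite !gt_eqF.
apply: (@no_accelerating_rotation _ (fun k => X (x k) / r (x k))
    (fun k => s * Y (x k) / r (x k)) _ (lam^-1 - 1) n).
- move=> k; rewrite -mulrA !exprMn s2 mul1r -mulrDl -rsq -exprMn divff ?expr1n //.
  by rewrite gt_eqF.
- by rewrite subr_gt0 invf_gt1.
- exact: large.
- by move=> j k jk; rewrite detE divr_gt0 ?sF ?mulr_gt0.
(* The factor [lam] in [r (x k.+1)] accounts for [1 + eps = lam^-1]; what remains is the strict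
   monotonicity of [f (x j)]. *)
- move=> j k jk; rewrite !detE rx subrKC.
  have -> : s * f (x j) (x k.+1) / (r (x j) * (lam * r (x k))) =
      lam^-1 * (s * f (x j) (x k.+1) / (r (x j) * r (x k))).
    by field; rewrite !gt_eqF.
  rewrite ltr_pM2l ?invr_gt0 // ltr_pM2r ?invr_gt0 ?mulr_gt0 //.
  have jk0 : (j < k <= j + n.+1)%N by lia.
  have jk1 : (j < k.+1 <= j + n.+1)%N by lia.
  have := outlying_between (s := x k) (outlying_x _ _ jk1).
  have [_ _ xkj _] := outlying_x _ _ jk0; rewrite x_dec xkj => /(_ isT).
  have := sF _ _ jk0.
  by move: s2 => /eqP; rewrite sqrf_eq1 => /pred2P[]->; nra.
Qed.

End NoSupport.

End PlaneCurve.

(** * Choice of constants, and segments of the extended real line *)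

(** By [1 + x <= expR x], [lam^-1 - 1 >= c / (n + 1)], and [c * n > n + 1] once [n * (c - 1) > 1].
    The condition [c > 1] is the origin of the constant 1/e. *)
Lemma exists_ratio (R : realType) (c : R) : 1 < c ->
  exists lam n, [/\ 0 < lam < 1, lam ^+ n.+1 = expR (- c) &
    1 < (lam^-1 - 1) * n%:R].
Proof.
move=> c_gt1; have d_gt0 : 0 < c - 1 by rewrite subr_gt0.
pose n := Num.bound (c - 1)^-1.
have nc : 1 < n%:R * (c - 1).
  by rewrite -ltr_pdivrMr // div1r archi_boundP // invr_ge0 ltW.
have n1 : 0 < n.+1%:R :> R by [].
exists (expR (- (c / n.+1%:R))), n; split.
- by rewrite expR_gt0 expR_lt1 oppr_lt0 divr_gt0 // (lt_trans ltr01).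
- by rewrite -expRM_natr mulNr divfK // gt_eqF.
- rewrite -expRN opprK; apply: lt_le_trans (_ : c / n.+1%:R * n%:R <= _).
    by rewrite mulrAC ltr_pdivlMr // mul1r -natr1; lra.
  by rewrite ler_wpM2r // lerBrDl expR_ge1Dx.
Qed.

(** The bound [t0] is real even for [a = -oo], which allows the argument to run over real
    parameters. *)
Lemma nbhs_right_segment (R : realType) (a b : \bar R) (P : set (\bar R)) :
  (a < b)%O -> nbhs a P ->
  exists2 t0 : R, (a < t0%:E)%O &
    forall x, (a < x < t0%:E)%O -> P x /\ (x < b)%O.
Proof.
move=> ab aP.
have : nbhs a (P `&` [set x | (x < b)%O]).
  apply: filterI => //; apply: open_nbhs_nbhs; split => //.
  exact: open_ereal_lt_ereal.
case: a ab {aP} => [a||] ab; last 2 first.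
- by rewrite ltNge leey in ab.
- move=> [M [_ MP]]; exists M; rewrite ?ltNyr // => x /andP[_]; exact: MP.
- move=> /nbhs_EFin/near_itv_radius[e e_gt0 aP].
  exists (a + e); first by rewrite lte_fin ltrDl.
  move=> [x||] /andP[ax xe]; last by rewrite ltNge leNye in ax.
    by apply: aP; rewrite !lte_fin in ax xe; rewrite (lt_trans _ ax) ?gtrBl.
  by rewrite ltNge leey in xe.
Qed.

Lemma real_between (R : realType) (a : \bar R) (y : R) :
  (a < y%:E)%O -> exists2 x : R, (a < x%:E)%O & x < y.
Proof.
case: a => [a||] ay; last by exists (y - 1); rewrite ?ltNyr // gtrBl.
  by rewrite lte_fin in ay; exists ((a + y) / 2); rewrite ?lte_fin midf_lt.
by rewrite ltNge leey in ay.
Qed.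

Lemma open_right_segment (R : realType) (a : \bar R) (t : R) :
  open [set x : R | (a < x%:E < t%:E)%O].
Proof.
case: a => [a||].
- rewrite (_ : [set _ | _] = [set` `]a, t[]); first exact: interval_open.
  by apply/seteqP; split => x /=; rewrite in_itv /= !lte_fin.
- rewrite (_ : [set _ | _] = set0); first exact: open0.
  by apply/seteqP; split => x //=; rewrite ltNge leey.
- rewrite (_ : [set _ | _] = [set` `]-oo, t[]); first exact: interval_open.
  by apply/seteqP; split => x /=; rewrite in_itv /= ltNyr lte_fin.
Qed.

Lemma lt_expRN1 (R : realType) (m : \bar R) : (m < (expR (-1))%:E)%E ->
  exists2 c : R, 1 < c & (m <= (expR (- c))%:E)%E.
Proof.
case: m => [m||] lt_m; last by exists 2; rewrite ?leNye // ltr1n.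
  2: by rewrite ltNge leey in lt_m.
(* Since [m] may be nonpositive, the maximum with a positive number below [expR (-1)] makes [ln]
   applicable. *)
move: lt_m; rewrite lte_fin => m_lt; pose w := Num.max m (expR (- 2)).
have w_gt0 : 0 < w by rewrite lt_max expR_gt0 orbT.
have w_lt : w < expR (-1) by rewrite gt_max m_lt ltr_expR ltrN2 ltr1n.
exists (- ln w); rewrite ?opprK ?lnK ?lee_fin ?le_max ?lexx //.
by rewrite ltrNr -(expRK (-1)) ltr_ln ?posrE ?expR_gt0.
Qed.

(** * Passage to real parameters, with the origin moved to [gamma a] *)

Section Restriction.
Variables (R : realType) (a b : \bar R) (gamma : \bar R -> R * R).
Let D := [set x : \bar R | (a <= x < b)%O].
Hypothesis gammaC : {within D, continuous gamma}.
Let X (x : R) := (gamma x%:E).1 - (gamma a).1.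
Let Y (x : R) := (gamma x%:E).2 - (gamma a).2.

Lemma DfunE x : Num.sqrt (X x ^+ 2 + Y x ^+ 2) = Dfun gamma a x%:E.
Proof. by rewrite /Dfun /edist /X /Y -sqrrN opprB -(sqrrN (_ - (gamma a).2)) opprB. Qed.

Lemma continuous_coordinates x : (a < x%:E < b)%O ->
  {for x, continuous X} /\ {for x, continuous Y}.
Proof.
move=> /andP[ax xb].
have Dx : D x%:E by rewrite /D /= (ltW ax).
have /subspace_continuousP gD := gammaC.
have contg : gamma y%:E @[y --> x] --> gamma x%:E.
  move=> V gxV; have gV := gD _ Dx V gxV.
  have na : nbhs x%:E [set y | (a < y)%O].
    by apply: open_nbhs_nbhs; split => //; exact: open_ereal_gt_ereal.
  have nb : nbhs x%:E [set y | (y < b)%O].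
    by apply: open_nbhs_nbhs; split => //; exact: open_ereal_lt_ereal.
  have : nbhs x%:E (gamma @^-1` V).
    by apply: filterS3 na nb gV => y ay yb; apply; rewrite /D /= (ltW ay).
  by move=> /nbhs_EFin.
split.
- apply: cvgB; last exact: cvg_cst.
  by apply: cvg_comp contg _; apply: cvg_fst.
- apply: cvgB; last exact: cvg_cst.
  by apply: cvg_comp contg _; apply: cvg_snd.
Qed.

Lemma near_origin_small e : (a < b)%O -> 0 < e ->
  nbhs a [set y | D y -> Dfun gamma a y < e].
Proof.
move=> ab e_gt0; have Da : D a by rewrite /D /= lexx ab.
have /subspace_continuousP /(_ _ Da) ga := gammaC.
have e2 : 0 < e / 2 by rewrite divr_gt0.
have g1 : (gamma y).1 @[y --> within D (nbhs a)] --> (gamma a).1.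
  by apply: cvg_comp ga _; apply: cvg_fst.
have g2 : (gamma y).2 @[y --> within D (nbhs a)] --> (gamma a).2.
  by apply: cvg_comp ga _; apply: cvg_snd.
have n1 : \forall y \near within D (nbhs a), `|(gamma a).1 - (gamma y).1| < e / 2.
  exact: cvgr_dist_lt g1 _ e2.
have n2 : \forall y \near within D (nbhs a), `|(gamma a).2 - (gamma y).2| < e / 2.
  exact: cvgr_dist_lt g2 _ e2.
apply: filterS2 n1 n2 => y H1 H2.
rewrite /Dfun /edist -(ger0_norm (ltW e_gt0)) -sqrtr_sqr ltr_sqrt ?exprn_gt0 //.
have s1 : ((gamma a).1 - (gamma y).1) ^+ 2 < (e / 2) ^+ 2.
  by rewrite -real_normK ?num_real // ltrXn2r // nnegrE ?normr_ge0 // ltW.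
have s2 : ((gamma a).2 - (gamma y).2) ^+ 2 < (e / 2) ^+ 2.
  by rewrite -real_normK ?num_real // ltrXn2r // nnegrE ?normr_ge0 // ltW.
apply: lt_le_trans (ltrD s1 s2) _.
by rewrite expr_div_n; have := sqr_ge0 e; lra.
Qed.

(** The two determinants differ by a term independent of [y], and neighbourhoods of [x] in [R] map
    onto neighbourhoods in the extended line. *)
Lemma support_of_extremum t x : (a < x%:E)%O -> x <= t ->
  local_extremum (fun y => X t * Y y - Y t * X y) x ->
  Sset a b gamma t%:E x%:E.
Proof.
move=> ax xt ext; split; first by rewrite ax lee_fin.
split => [|_]; first by rewrite (ltW ax) lee_fin.
have detE y : chord_det (gamma a) (gamma t%:E) (gamma y%:E) =
    (X t * Y y - Y t * X y) + (X t * (gamma a).2 - Y t * (gamma a).1).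
  by rewrite /chord_det /X /Y; ring.
case: ext => /nbhs_image_EFin nU; eexists; (split; first exact: nU); [left|right].
- by move=> _ [y Uy <-] _; rewrite !detE lerD2r.
- by move=> _ [y Uy <-] _; rewrite !detE lerD2r.
Qed.

End Restriction.

Theorem theorem1 (R : realType) (a b : \bar R) (gamma : \bar R -> R * R) :
  (a < b)%O ->
  {within [set x | (a <= x < b)%O], continuous gamma} ->
  (forall U, nbhs a U ->
     exists tau, U tau /\ (a <= tau < b)%O /\ gamma tau <> gamma a) ->
  ((expR (-1))%:E <=
     limf_esup (ratioDS a b gamma) (within [set t | (a < t < b)%O] (nbhs a)))%E.
Proof.
move=> ab gammaC _.
(* The upper limit is an infimum of suprema, so a value below 1/e yields one set [A] on which the
   ratio is at most [expR (- c)]. *)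
rewrite leNgt; apply/negP => /ereal_inf_lt[_ [A nA <-]] /lt_expRN1[c c_gt1 supA].
have [lam [n [lam01 lamE large]]] := exists_ratio c_gt1.
have ratio_le t : A t -> (ratioDS a b gamma t <= (expR (- c))%:E)%E.
  by move=> At; apply: le_trans supA; apply: ereal_sup_ubound; exists t.
have [t0 at0 t0P] := nbhs_right_segment ab nA.
pose J := [set x : R | (a < x%:E < t0%:E)%O].
have J_lt x : J x -> (a < x%:E < b)%O.
  by move=> Jx; have [_ xb] := t0P _ Jx; case/andP: Jx => ->.
have J_A x : J x -> A x%:E.
  by move=> Jx; have [+ _] := t0P _ Jx; apply; apply: J_lt.
(* Where the distance vanishes the ratio is [+oo] by convention, which the bound on [A] excludes. *)
have r_neq0 x : J x -> Dfun gamma a x%:E != 0.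
  by move=> Jx; apply/negP => D0; have := ratio_le _ (J_A _ Jx); rewrite /ratioDS D0.
have r_gt0 x : J x -> 0 < Dfun gamma a x%:E.
  by move=> Jx; rewrite lt_neqAle eq_sym r_neq0 // sqrtr_ge0.
have [z az zt0] := real_between at0.
pose X (x : R) := (gamma x%:E).1 - (gamma a).1.
pose Y (x : R) := (gamma x%:E).2 - (gamma a).2.
apply: (@no_support_contradiction R J X Y _ _ _ _ _ _ (expR (- c)) _ _ lam n z) => //.
- exact: open_right_segment.
- move=> x y s /andP[ax _] /andP[_ yt] /andP[xs sy]; apply/andP; split.
    by rewrite (lt_le_trans ax) ?lee_fin.
  by rewrite (le_lt_trans _ yt) ?lee_fin.
- by move=> x /J_lt Jx; have [] := continuous_coordinates gammaC Jx.
- by move=> x /J_lt Jx; have [] := continuous_coordinates gammaC Jx.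
- by move=> x Jx; rewrite DfunE r_gt0.
- move=> y e /andP[ay yt] e_gt0.
  have ns := near_origin_small gammaC ab e_gt0.
  (* With [y] in the role of the right end, the parameter found also lies before [y]. *)
  have [t1 at1 t1P] := nbhs_right_segment ay ns.
  have [x ax xt1] := real_between at1.
  have [|xe xy] := t1P x%:E; first by rewrite ax lte_fin.
  exists x; split => //.
  + by rewrite /J /= ax (lt_trans xy).
  + rewrite DfunE; apply: xe; rewrite /= (ltW ax) /=.
    by apply: lt_trans xy _; have /andP[] : (a < y%:E < b)%O by apply: J_lt; rewrite /J /= ay.
- by rewrite expR_lt1 oppr_lt0 (lt_trans ltr01).
- move=> t x Jt Jx xt; rewrite !DfunE ltNge => /negP + ext; apply.
  rewrite -ler_pdivrMr ?r_gt0 // -lee_fin.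
  (* An extremum at [x] puts [x] into [Sset], so [D x / D t] is at most the ratio at [t]. *)
  apply: le_trans (ratio_le _ (J_A _ Jt)); rewrite /ratioDS (negPf (r_neq0 _ Jt)).
  rewrite EFinM; apply: lee_wpmul2r; first by rewrite lee_fin invr_ge0 ltW ?r_gt0.
  apply: ereal_sup_ubound; exists x%:E => //.
  by apply: support_of_extremum ext; [case/andP: Jx|exact: ltW].
- by rewrite /J /= az lte_fin.
- by rewrite lamE.
Qed.
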